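(* Let $k\ge 2$ and let $H=(V,E)$ be a countable, simple, $k$-uniform hypergraph with countably infinite vertex set. The following are equivalent: (1) $H$ has property $C_k$, i.e. there is a set $V'\subseteq V$ such that every $v\in V'$ lies in infinitely many edges $e\in E$ with $|V'\cap e|\ge k$ (equivalently $e\subseteq V'$). (2) For every labeling $\phi$ of $V$ by $\mathbb{N}$ there exists an infinite increasing $(k-1)$-branching tree in $H$. (3) For every labeling $\phi$ of $V$ by $\mathbb{N}$ there exists an infinite increasing path in $H$.
   Context: A hypergraph is simple if any two distinct vertices lie in at most one common edge. A labeling of $V$ by $\mathbb{N}$ is a bijection $\phi:V\to\mathbb{N}$. An infinite increasing path in $H$ (with respect to $\phi$) is a sequence of distinct vertices $v_1,v_2,\dots$ together with edges $e_0,e_1,\dots$ of $H$ such that $e_i=\{v_{(k-1)i+1},v_{(k-1)i+2},\dots,v_{(k-1)i+k}\}$ for all $i\ge 0$ and $\phi(v_j)<\phi(v_{j+1})$ for all $j\ge1$. The infinite $(k-1)$-branching tree is the unique (up to isomorphism) $k$-uniform hypergraph with a distinguished root vertex in which every pair of vertices is connected by a unique (loose) path, the root has degree $1$ and every other vertex has degree $2$; equivalently, the root lies in one edge, and every non-root vertex $v$ of an edge lies in exactly one further edge consisting of $v$ and $k-1$ new vertices. For a vertex $v$ of this tree, $t(v)$ denotes the number of edges on the path from $v$ to the root ($t(\text{root})=0$). An infinite increasing $(k-1)$-branching tree in $H$ is a subhypergraph of $H$ isomorphic to the infinite $(k-1)$-branching tree such that for all its vertices $x,y$ with $t(x)<t(y)$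 we have $\phi(x)<\phi(y)$.
   Formalization: In (1) the set V' is required to be non-empty; with V' empty the condition holds vacuously in every hypergraph (e.g. one with no edges), and the equivalence would fail. *)

(* Defs.v *)
From HB Require Import structures.
From mathcomp Require Import all_boot finmap.
From mathcomp Require Import boolp classical_sets cardinality.

Set Implicit Arguments.
Unset Strict Implicit.
Unset Printing Implicit Defensive.

Local Open Scope nat_scope.
Local Open Scope fset_scope.
Local Open Scope classical_set_scope.
Local Open Scope card_scope.

Definition uniform (V : choiceType) (k : nat) (E : set {fset V}) : Prop :=
  forall e, E e -> #|` e| = k.

Definition simple (V : choiceType) (E : set {fset V}) : Prop :=
  forall x y : V, x != y ->
  forall e f : {fset V},
    E e -> E f -> x \in e -> y \in e -> x \in f -> y \in f -> e = f.

(* [V'] must be nonempty: the empty set satisfies the second clause in every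
   hypergraph. *)
Definition property_C (V : choiceType) (k : nat) (E : set {fset V}) : Prop :=
  exists V' : set V,
    V' !=set0 /\
    forall v, V' v ->
      infinite_set
        [set e | [/\ E e, v \in e & k <= #|` [fset x in e | x \in V']|]].

(* Vertices of paths are numbered from 0, so [v j] is $v_{j+1}$ and
   [path_edge k v i] is $\{v_{(k-1)i+1},\dots,v_{(k-1)i+k}\}$. *)
Definition path_edge (V : choiceType) (k : nat) (v : nat -> V) (i : nat)
  : {fset V} := [fset v j | j in iota (k.-1 * i) k].

Definition increasing_path (V : choiceType) (k : nat) (E : set {fset V})
    (phi : V -> nat) : Prop :=
  exists (v : nat -> V) (e : nat -> {fset V}),
    [/\ injective v,
        forall i, E (e i) /\ e i = path_edge k v i
      & forall j, phi (v j) < phi (v j.+1)].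

(* A finite loose path is identified with its sequence of edges [p]; the order
   of the inner vertices of an edge is not part of the path (otherwise paths
   would not be unique in a tree once k >= 4). Only the values of [v] up to
   [k.-1 * size p] matter, and [p = [::]] forces [x = y]. *)
Definition loose_path (V : choiceType) (k : nat) (F : set {fset V})
    (x y : V) (p : seq {fset V}) : Prop :=
  exists v : nat -> V,
    [/\ {in [pred j | j <= k.-1 * size p] &, injective v},
        v 0 = x,
        v (k.-1 * size p) = y
      & forall i, i < size p ->
          F (nth fset0 p i) /\ nth fset0 p i = path_edge k v i].

Definition has_degree (V : choiceType) (F : set {fset V}) (x : V) (d : nat)
  : Prop := [set e | F e /\ x \in e] #= `I_d.

(* The hypergraph with vertex set [W] and edge set [F], rooted at [r], is an
   infinite (k-1)-branching tree. These conditions determine the rooted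
   hypergraph up to isomorphism and are invariant under isomorphism, so this is
   the same as being isomorphic to the infinite (k-1)-branching tree. *)
Definition branching_tree (V : choiceType) (k : nat)
    (W : set V) (F : set {fset V}) (r : V) : Prop :=
  [/\ W r,
      uniform k F /\ (forall e, F e -> [set` e] `<=` W),
      forall x y, W x -> W y -> exists! p, loose_path k F x y p,
      has_degree F r 1
    & forall x, W x -> x != r -> has_degree F x 2].

(* In a tree the path is unique, so the choice made by [xget] is harmless. *)
Definition depth (V : choiceType) (k : nat) (F : set {fset V}) (r x : V)
  : nat := size (xget [::] [set p | loose_path k F x r p]).

Definition increasing_tree (V : choiceType) (k : nat) (E : set {fset V})
    (phi : V -> nat) : Prop :=
  exists (W : set V) (F : set {fset V}) (r : V),
    [/\ F `<=` E,
        branching_tree k W F r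
      & forall x y, W x -> W y ->
          depth k F r x < depth k F r y -> phi x < phi y].

(* Main.v *)
Require Import Defs.
From mathcomp Require Import all_boot finmap zify.
From mathcomp Require Import boolp classical_sets cardinality.

(* (1) => (2): inside V', by simplicity, every vertex lies in an edge whose other
   vertices all have large labels, so the tree can be grown in breadth-first
   order with increasing labels.

   (2) => (3): start at the root and repeatedly leave the vertex of largest label
   of the current edge through its other edge; depth grows by one at each edge.

   (3) => (1): call A tame if it has a labeling under which no infinite sequence
   x_0, x_1, ... has x_(i+1) the largest vertex in A of an edge containing x_i,
   and if every edge meeting A can be charged to one of its vertices in A so that
   each vertex is charged finitely often. Tameness survives the addition of a
   vertex that lies in finitely many edges missing A, and survives countable
   unions. So there is a largest tame set, and, unless it is V, its complement
   witnesses C_k.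

   For a union of sets A_n, let [idx x] be the least n with x in A_n. Vertices are
   released in finite stages and labeled by stage, then by decreasing [idx], then
   by the labeling of A_[idx x]. The edges charged to a vertex force their
   vertices of larger index into its stage or, above a cutoff, into the next one.
   An increasing sequence then raises [idx] only finitely often, so it ends up
   inside a single A_n. *)

Set Implicit Arguments.
Unset Strict Implicit.
Unset Printing Implicit Defensive.

(** * Tame sets *)

Lemma fset_bigcupP (I T : choiceType) (r : {fset I}) (F : I -> {fset T}) (y : T) :
  reflect (exists2 x, x \in r & y \in F x) (y \in \bigcup_(x <- r) F x)%fset.
Proof.
apply: (iffP (bigfcupP _ _ _ _)) => -[x]; first by rewrite andbT; exists x.
by move=> xr yx; exists x; rewrite ?andbT.
Qed.

(** Each [up] step raises [idx] and [down] steps keep it, so an element with [idx] at most [d] can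
    only appear within the first [d] rounds of [up]; finitely many rounds close the set. *)
Lemma cutoff_closure (V : choiceType) (idx : V -> nat) (up down : V -> {fset V})
    (T : {fset V}) (d : nat) :
  (forall x y, y \in up x -> idx x < idx y) ->
  (forall x, x \in down x) ->
  (forall x y, y \in down x -> idx y = idx x) ->
  (forall x y z, y \in down x -> z \in down y -> z \in down x) ->
  exists C : {fset V},
    [/\ {subset T <= C},
        forall x y, x \in C -> y \in down x -> y \in C
      & forall x y, x \in C -> idx x <= d -> y \in up x -> y \in C].
Proof.
move=> up_idx down_refl down_idx down_trans.
pose Dn (X : {fset V}) := (\bigcup_(x <- X) down x)%fset.
pose Un (X : {fset V}) := (\bigcup_(x <- X) up x)%fset.
have DnP X y : reflect (exists2 x, x \in X & y \in down x) (y \in Dn X).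
  exact: fset_bigcupP.
have UnP X y : reflect (exists2 x, x \in X & y \in up x) (y \in Un X).
  exact: fset_bigcupP.
(* [Y m] is what at most [m] steps of [up] reach from [T]; as [down] is transitive, one application
   of [Dn] per round is enough. *)
pose Y m := iter m (fun X => Dn (T `|` Un X)%fset) (Dn T).
have Y_stable m x : x \in Y m.+1 -> idx x <= m -> x \in Y m.
  elim: m x => [|m IH] x /DnP[w]; rewrite in_fsetU => /orP[wT|/UnP[w' w'Y ww']] xw le_m.
  - by apply/DnP; exists w.
  - by have := up_idx _ _ ww'; rewrite -(down_idx _ _ xw); lia.
  - by apply/DnP; exists w; rewrite // in_fsetU wT.
  - apply/DnP; exists w => //; rewrite in_fsetU; apply/orP; right.
    apply/UnP; exists w' => //; apply: IH => //.
    by have := up_idx _ _ ww'; rewrite -(down_idx _ _ xw); lia.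
exists (Y d.+1); split=> [x xT|x y /DnP[w wX xw] yx|x y xY le_d yx].
- by apply/DnP; exists x; rewrite // in_fsetU xT.
- by apply/DnP; exists w => //; apply: down_trans yx.
- apply/DnP; exists y => //; rewrite in_fsetU; apply/orP; right.
  by apply/UnP; exists x => //; apply: Y_stable.
Qed.

(* The elements [v] with [idx v <= d (st v)] have all of [up v] at their own
   stage or before; only those above the cutoff [d (st v)] reach the next stage,
   and there they land below its cutoff. *)
Lemma staging (V : countType) (idx : V -> nat) (up down : V -> {fset V}) :
  (forall x y, y \in up x -> idx x < idx y) ->
  (forall x, x \in down x) ->
  (forall x y, y \in down x -> idx y = idx x) ->
  (forall x y z, y \in down x -> z \in down y -> z \in down x) ->
  exists (d : nat -> nat) (st : V -> nat),
    [/\ {homo d : m n / m <= n},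
        forall s, exists C : {fset V}, forall x, st x <= s -> x \in C,
        forall x y, y \in down x -> st y <= st x
      & forall x y, y \in up x -> st y <= st x \/
          [/\ st y <= (st x).+1, d (st x) < idx x & idx y <= d (st x).+1]].
Proof.
move=> up_idx down_refl down_idx down_trans.
(* A state is a finite set with its cutoff; the third component, the stage number, doubles as the
   code of a vertex to absorb, so that every vertex is eventually released. *)
pose next (S : {fset V} * nat * nat) (S' : {fset V} * nat) :=
  [/\ {subset S.1.1 <= S'.1} /\ (forall x : V, choice.pickle x = S.2 -> x \in S'.1),
      S.1.2 <= S'.2,
      forall x y, x \in S.1.1 -> y \in up x -> y \in S'.1 /\ idx y <= S'.2,
      forall x y, x \in S'.1 -> y \in down x -> y \in S'.1
    & forall x y, x \in S'.1 -> idx x <= S'.2 -> y \in up x -> y \in S'.1].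
have /choice[g gP] : forall S, exists S', next S S'.
  move=> [[C d] n].
  pose U := (\bigcup_(x <- C) up x)%fset.
  (* The new cutoff covers all of [up] of the old set, whatever the index of the source. *)
  pose d' := maxn d (\max_(x <- U) idx x).
  pose T := (C `|` oapp (fun x => [fset x]) fset0 (choice.unpickle n) `|` U)%fset.
  have [C' [TC' C'down C'up]] := cutoff_closure T d' up_idx down_refl down_idx down_trans.
  exists (C', d'); split => //=.
  - split=> [x xC|x xn]; apply: TC'; first by rewrite !in_fsetU xC.
    by rewrite !in_fsetU -xn choice.pickleK /= in_fset1 eqxx orbT.
  - exact: leq_maxl.
  - move=> x y xC yx.
    have yU : y \in U by apply/bigfcupP; exists x; rewrite ?xC.
    split; first by apply: TC'; rewrite in_fsetU yU orbT.
    by apply: leq_trans (leq_maxr _ _); apply: leq_bigmax_seq.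
(* Stage 0 is empty, so [st] is positive and the closure clauses of [next], which concern [S s.+1],
   apply to the stage of every vertex. *)
pose S := fix S n := if n is m.+1 then g (S m, m) else ((fset0 : {fset V}), 0).
have SP n : next (S n, n) (S n.+1) by exact: gP.
have C_mono m n : m <= n -> {subset (S m).1 <= (S n).1}.
  move=> /subnK <-; elim: (n - m) => // p IH x xm; rewrite addSn.
  by have [[sub _] _ _ _ _] := SP (p + m); apply: sub; apply: IH.
have ex_st x : exists s, x \in (S s).1.
  by exists (choice.pickle x).+1; have [[_ ->]] := SP (choice.pickle x).
pose st x := ex_minn (ex_st x).
have st_in x : x \in (S (st x)).1 by rewrite /st; case: ex_minnP.
have st_min x s : x \in (S s).1 -> st x <= s.
  by move=> xs; rewrite /st; case: ex_minnP => ? _; apply.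
have st_gt0 x : 0 < st x.
  by have := st_in x; case: (st x) => //=; rewrite in_fset0.
exists (fun n => (S n).2), st; split.
- move=> m n /subnK <-; elim: (n - m) => // p IH; rewrite addSn.
  by have [_ le_d _ _ _] := SP (p + m); apply: leq_trans IH _.
- by move=> s; exists (S s).1 => x le_s; apply: C_mono le_s _ _.
- move=> x y yx; apply: st_min; have := st_in x; have := st_gt0 x.
  case: (st x) => // s _ xs; have [_ _ _ down_cl _] := SP s.
  exact: down_cl yx.
- move=> x y yx; have [le_d|lt_d] := leqP (idx x) (S (st x)).2; [left|right].
    apply: st_min; move: le_d; have := st_in x; have := st_gt0 x.
    case: (st x) => // s _ xs le_d; have [_ _ _ _ up_cl] := SP s.
    exact: up_cl yx.
  have [_ _ /(_ x y (st_in x) yx)[yS le_y] _ _] := SP (st x).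
  by split=> //; apply: st_min.
Qed.

(** A finite stage bounds [idx] and [f] on it, so each stage [s] can be given its own block of
    [(b s).+1 ^ 2] consecutive labels. *)
Lemma lexicographic_label (V : choiceType) (st idx f : V -> nat) :
  (forall s, exists C : {fset V}, forall x, st x <= s -> x \in C) ->
  exists phi : V -> nat, forall x y,
    [\/ st x < st y, st x = st y /\ idx y < idx x |
        [/\ st x = st y, idx x = idx y & f x < f y]] -> phi x < phi y.
Proof.
move=> /choice[C CP].
pose b s := \max_(x <- C s) maxn (idx x) (f x).
have bP x : idx x <= b (st x) /\ f x <= b (st x).
  have: maxn (idx x) (f x) <= b (st x).
    by apply: (leq_bigmax_seq _ (CP _ _ (leqnn _))).
  by rewrite geq_max => /andP[].
(* A two-digit number in base [(b (st x)).+1]; the subtraction, never truncated by [bP], reverses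
   the order of [idx]. *)
pose loc x := (b (st x) - idx x) * (b (st x)).+1 + f x.
pose L s := \sum_(t < s) (b t).+1 ^ 2.
have locP x : loc x < (b (st x)).+1 ^ 2.
  by have [] := bP x; rewrite /loc -mulnn; nia.
have L_mono s t : s < t -> L s + (b s).+1 ^ 2 <= L t.
  move=> /subnK <-; elim: (t - s.+1) => [|p IH]; first by rewrite /L big_ord_recr.
  by apply: leq_trans IH _; rewrite /L addSn big_ord_recr leq_addr.
exists (fun x => L (st x) + loc x) => x y [lt_st|[eq_st lt_i]|[eq_st eq_i lt_f]].
- by have := L_mono _ _ lt_st; have := locP x; lia.
- have [le_i le_f] := bP x; rewrite /loc eq_st in le_i le_f *.
  have : (b (st y) - idx x).+1 * (b (st y)).+1 <= (b (st y) - idx y) * (b (st y)).+1.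
    by apply: leq_mul => //; lia.
  by rewrite mulSn; lia.
- by rewrite /loc eq_st eq_i; lia.
Qed.

Lemma finite_inj_bounded (T : Type) (A : set T) (f : T -> nat) (N : nat) :
  (forall x y, A x -> A y -> f x = f y -> x = y) ->
  (forall x, A x -> f x <= N) -> finite_set A.
Proof.
move=> f_inj f_le; rewrite -(eq_finite_set (@inj_card_eq _ _ A f _)); last first.
  by move=> x y; rewrite !inE => Ax Ay; apply: f_inj.
apply: sub_finite_set (finite_II N.+1) => _ [x Ax <-] /=.
by rewrite ltnS f_le.
Qed.

Lemma finite_fset_ex (T : choiceType) (A : set T) :
  finite_set A -> exists X : {fset T}, forall y, (y \in X) <-> A y.
Proof. by move=> /finite_fsetP[X ->]; exists X. Qed.

Lemma ex_least (P : nat -> Prop) : (exists n, P n) ->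
  exists2 n, P n & forall m, P m -> n <= m.
Proof.
move=> [n Pn]; have ex : exists n, `[< P n >] by exists n; apply/asboolP.
case: (ex_minnP ex) => m /asboolP Pm le_m; exists m => // p Pp.
by apply: le_m; apply/asboolP.
Qed.

(** * Tameness, its closure properties and the largest tame set *)

Definition max_step (V : choiceType) (E : set {fset V}) (A : set V)
    (phi : V -> nat) (x y : V) : Prop :=
  exists2 e, E e & [/\ x \in e, y \in e, phi x < phi y
    & forall z, z \in e -> A z -> phi z <= phi y].

(** Labels are compared on [A] only and need not exhaust the naturals, which leaves room for
    extending [A]; the passage to a bijective labeling comes at the end. The value of [own] on edges
    missing [A] is arbitrary. *)
Definition tame (V : choiceType) (E : set {fset V}) (A : set V) : Prop :=
  exists (phi : V -> nat) (own : {fset V} -> V),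
    [/\ forall x y, A x -> A y -> phi x = phi y -> x = y,
        forall a : nat -> V, (forall i, A (a i)) ->
          ~ (forall i, max_step E A phi (a i) (a i.+1)),
        forall e x, E e -> x \in e -> A x -> own e \in e /\ A (own e)
      & forall v, finite_set
          [set e | [/\ E e, own e = v & exists2 x, x \in e & A x]]%classic].

Lemma increasing_homo (T : Type) (phi : T -> nat) (a : nat -> T) :
  (forall i, phi (a i) < phi (a i.+1)) -> {homo a : i j / i < j >-> phi i < phi j}.
Proof. by apply: homo_ltn => y x z; apply: ltn_trans. Qed.

Lemma increasing_inj (T : Type) (phi : T -> nat) (a : nat -> T) :
  (forall i, phi (a i) < phi (a i.+1)) -> injective a.
Proof.
move=> /increasing_homo a_lt i j eq_a.
by case: (ltngtP i j) => // /a_lt; rewrite eq_a ltnn.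
Qed.

Lemma nonincreasing_stable (u : nat -> nat) :
  (forall i, u i.+1 <= u i) -> exists n, forall i, n <= i -> u i = u n.
Proof.
move=> u_le; have u_mono : {homo u : i j / i <= j >-> j <= i}.
  by apply: homo_leq => // y x z le_yx le_zy; apply: leq_trans le_yx.
have [_ [n ->] u_min] : exists2 m, exists n, m = u n & forall m', (exists n, m' = u n) -> m <= m'.
  by apply: ex_least; exists (u 0), 0.
exists n => i le_ni; apply/eqP; rewrite eqn_leq u_mono //= u_min //.
by exists i.
Qed.

Lemma finite_fibers_escape (V : choiceType) (st : V -> nat) (s : nat) (C : {fset V})
    (a : nat -> V) :
  (forall x, st x <= s -> x \in C) -> injective a ->
  (forall i, st (a i) <= st (a i.+1)) -> exists n, forall i, n <= i -> s < st (a i).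
Proof.
move=> CP a_inj st_mono.
have mono : {homo (fun i => st (a i)) : i j / i <= j} by apply: homo_leq leqnn leq_trans _.
suff [n lt_n] : exists n, s < st (a n).
  by exists n => i /mono; apply: leq_trans.
apply: contrapT => /forallNP no.
have aC i : a i \in C by apply: CP; rewrite leqNgt; apply/negP/no.
apply: infinite_nat; rewrite -(eq_finite_set (@inj_card_eq _ _ _ a _)); last first.
  by move=> x y _ _; apply: a_inj.
by apply: sub_finite_set (finite_fset C) => _ [i _ <-]; apply: aC.
Qed.

(** An edge is charged through the least [A n] that it meets. In a step of an increasing sequence,
    either the target has the least index in its edge, so [idx] does not rise, or the target enters
    the stage just after that of the owner of the edge. The latter happens finitely often, after
    which [idx] stabilizes at some [m] and the sequence contradicts the tameness of [A m]. *)
Lemma tame_bigcup (V : countType) (E : set {fset V}) (A : nat -> set V) :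
  (forall n, tame E (A n)) -> tame E (\bigcup_n A n)%classic.
Proof.
move=> /choice[phi /choice[own H]].
have phi_inj n x y : A n x -> A n y -> phi n x = phi n y -> x = y by have [] := H n; auto.
have no_seq n := let: And4 _ h _ _ := H n in h.
have own_in n e x : E e -> x \in e -> A n x -> own n e \in e /\ A n (own n e).
  by have [_ _ h _] := H n; apply: h.
have own_fin n := let: And4 _ _ _ h := H n in h.
set U := (\bigcup_n A n)%classic.
have /choice[idx idxP] : forall x, exists n, U x -> A n x /\ forall m, A m x -> n <= m.
  move=> x; have [[n _ Anx]|nUx] := pselect (U x); last by exists 0.
  have [m Am m_min] : exists2 m, A m x & forall m', A m' x -> m <= m'.
    by apply: ex_least; exists n.
  by exists m.
(* [low e] is the least index of a vertex of [e] in [U], with default 0 when there is none. *)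
have /choice[low lowP] : forall e : {fset V}, exists n, forall x, x \in e -> U x ->
    n <= idx x /\ exists2 y, y \in e & A n y.
  move=> e; have [[x xe Ux]|no_x] := pselect (exists2 x, x \in e & U x); last first.
    by exists 0 => x xe Ux; case: no_x; exists x.
  have [m [y [ye Uy <-]] m_min] : exists2 m, (exists y, [/\ y \in e, U y & idx y = m])
      & forall m', (exists y, [/\ y \in e, U y & idx y = m']) -> m <= m'.
    by apply: ex_least; exists (idx x), x.
  exists (idx y) => z ze Uz; split; first by apply: m_min; exists z.
  by exists y => //; have [] := idxP y Uy.
pose ow e := own (low e) e.
have owP e x : E e -> x \in e -> U x ->
    [/\ ow e \in e, U (ow e), idx (ow e) = low e & low e <= idx x].
  move=> Ee xe Ux; have [le_x [y ye Ay]] := lowP _ _ xe Ux.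
  have [oe Ao] := own_in _ _ _ Ee ye Ay.
  have Uo : U (ow e) by exists (low e).
  have [le_o _] := lowP _ _ oe Uo; have [_ /(_ _ Ao) o_le] := idxP _ Uo.
  by split=> //; apply/eqP; rewrite eqn_leq le_o o_le.
have ow_fin v : finite_set [set e | [/\ E e, ow e = v & exists2 x, x \in e & U x]]%classic.
  apply: sub_finite_set (own_fin (idx v) v) => e [Ee ow_e [x xe Ux]].
  have [_ _ idx_e _] := owP _ _ Ee xe Ux.
  have [_ [y ye Ay]] := lowP _ _ xe Ux.
  by rewrite ow_e in idx_e; split; rewrite ?idx_e //; exists y.
pose f x := phi (idx x) x.
have f_inj x y : U x -> U y -> idx x = idx y -> f x = f y -> x = y.
  move=> Ux Uy eq_i; rewrite /f eq_i => /(@phi_inj (idx y)); apply.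
    by rewrite -eq_i; have [] := idxP _ Ux.
  by have [] := idxP _ Uy.
(* [up v] is finite because [v] is charged for finitely many edges, each of them finite. *)
have /choice[up upP] : forall v, exists X : {fset V}, forall y, (y \in X) <->
    exists2 e, E e /\ ow e = v & [/\ y \in e, U y & idx v < idx y].
  move=> v; apply: (@finite_fset_ex _ [set y | exists2 e,
      E e /\ ow e = v & [/\ y \in e, U y & idx v < idx y]]%classic).
  apply: sub_finite_set (bigcup_finite (ow_fin v) (fun e _ => finite_fset e)).
  move=> y [e [Ee ow_e] [ye Uy _]]; exists e => //=.
  by split=> //; exists y.
(* Finite because [f] is injective on vertices of one index. The disjunct [y = x] keeps [down]
   reflexive outside [U]. *)
have /choice[down downP] : forall x, exists X : {fset V}, forall y, (y \in X) <->
    (y = x \/ [/\ U y, idx y = idx x & f y <= f x]).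
  move=> x; apply: (@finite_fset_ex _
    ([set x] `|` [set y | [/\ U y, idx y = idx x & f y <= f x]])%classic).
  rewrite finite_setU; split; first exact: finite_set1.
  apply: (@finite_inj_bounded _ _ f (f x)) => [y z|y] [] //.
  by move=> Uy iy _ [Uz iz _]; apply: f_inj; rewrite ?iy ?iz.
have [|||| d [st [d_mono st_fin st_down st_up]]] := @staging _ idx up down.
- by move=> x y /upP[e _ []].
- by move=> x; apply/downP; left.
- by move=> x y /downP[->|[]].
- move=> x y z /downP[->//|[Uy iy fy]] /downP[->|[Uz iz fz]]; apply/downP; right => //.
  by split; rewrite ?iz //; apply: leq_trans fy.
have [psi psiP] := lexicographic_label idx f st_fin.
have st_le x y : psi x < psi y -> st x <= st y.
  by move=> lt_xy; rewrite leqNgt; apply/negP => /(@Or31 _ _ _)/psiP; lia.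
have idx_le x y : st x = st y -> psi x < psi y -> idx y <= idx x.
  move=> eq_st lt_xy; rewrite leqNgt; apply/negP => lt_i.
  suff /psiP : [\/ st y < st x, st y = st x /\ idx x < idx y |
    [/\ st y = st x, idx y = idx x & f y < f x]] by lia.
  by apply: Or32.
(* Stages are closed under [down]: among vertices of one index, a smaller [f] never comes at a later
   stage, so [psi] and [f] order them alike. *)
have f_le x y : U y -> idx x = idx y -> psi x <= psi y -> f x <= f y.
  move=> Uy eq_i le_xy; rewrite leqNgt; apply/negP => lt_f.
  have /st_down st_yx : y \in down x by apply/downP; right; split=> //; apply: ltnW.
  suff /psiP : [\/ st y < st x, st y = st x /\ idx x < idx y |
    [/\ st y = st x, idx y = idx x & f y < f x]] by lia.
  have [lt_st|eq_st] : st y < st x \/ st y = st x by lia.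
    exact: Or31.
  exact: Or33.
have psi_inj x y : U x -> U y -> psi x = psi y -> x = y.
  move=> Ux Uy eq_psi.
  have nlt z w : psi z = psi w -> ~ [\/ st z < st w, st z = st w /\ idx w < idx z |
    [/\ st z = st w, idx z = idx w & f z < f w]] by move=> e /psiP; lia.
  have nxy := nlt _ _ eq_psi; have nyx := nlt _ _ (esym eq_psi).
  have eq_st : st x = st y.
    by case: (ltngtP (st x) (st y)) => // h; [case: nxy|case: nyx]; apply: Or31.
  have eq_i : idx x = idx y.
    by case: (ltngtP (idx x) (idx y)) => // h; [case: nyx|case: nxy]; apply: Or32.
  apply: f_inj => //.
  by case: (ltngtP (f x) (f y)) => // h; [case: nxy|case: nyx]; apply: Or33.
have stepP x y : U x -> U y -> max_step E U psi x y ->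
    (exists s, [/\ d s < idx x, st y = s.+1 & idx y <= d s.+1]) \/
    idx y <= idx x /\ exists2 e, E e /\ low e = idx y &
      [/\ x \in e, y \in e, psi x < psi y & forall z, z \in e -> U z -> psi z <= psi y].
  move=> Ux Uy [e Ee [xe ye lt_xy max_y]].
  have [oe Uo idx_o le_y] := owP _ _ Ee ye Uy; have [_ _ _ le_x] := owP _ _ Ee xe Ux.
  have [lt_y|ge_y] := ltnP (low e) (idx y); last first.
    right; have eq_y : low e = idx y by apply/eqP; rewrite eqn_leq le_y ge_y.
    by rewrite -{1}eq_y; split=> //; exists e.
  (* Here [y] lies in [up (ow e)] and above its owner in [psi]. Within one stage a larger index
     would mean a smaller label, so [y] comes strictly later, which is the second alternative of
     [st_up]. *)
  left; exists (st (ow e)).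
  have y_up : y \in up (ow e) by apply/upP; exists e; rewrite ?idx_o.
  have lt_oy : psi (ow e) < psi y.
    rewrite ltn_neqAle max_y // andbT; apply/eqP => /(psi_inj _ _ Uo Uy) eq_oy.
    by move: lt_y; rewrite -idx_o eq_oy ltnn.
  have st_oy := st_le _ _ lt_oy.
  have ne_st : st (ow e) <> st y by move=> /idx_le/(_ lt_oy); lia.
  by have [|[]] := st_up _ _ y_up; [lia|split; lia].
exists psi, ow; split=> //; last first.
  by move=> e x Ee xe Ux; have [] := owP _ _ Ee xe Ux.
move=> a aU a_step.
have a_lt i : psi (a i) < psi (a i.+1) by have [e _ []] := a_step i.
have a_st i : st (a i) <= st (a i.+1) by apply: st_le.
pose bad i := exists s, [/\ d s < idx (a i), st (a i.+1) = s.+1 & idx (a i.+1) <= d s.+1].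
have a_inj := increasing_inj a_lt.
(* After a bad step into stage [s + 1], every later bad step ends in that stage
   again, which is finite. *)
have [n0 good] : exists n0, forall i, n0 <= i -> ~ bad i.
  have [[i0 [s [_ st_s idx_s]]]|no_bad] := pselect (exists i, bad i); last first.
    by exists 0 => i _ bi; apply: no_bad; exists i.
  (* From below the cutoff [d s.+1], a bad step has [s' <= s] by monotonicity of [d], so it lands
     below the same cutoff; a good step does not raise [idx]. *)
  have stay p : s < st (a (i0.+1 + p)) /\ idx (a (i0.+1 + p)) <= d s.+1.
    elim: p => [|p [IHs IHd]]; first by rewrite addn0 st_s.
    rewrite addnS; split; first exact: leq_trans IHs (a_st _).
    have [[s' [d_s' st_s' idx_s']]|[le_i _]] := stepP _ _ (aU _) (aU _) (a_step (i0.+1 + p)).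
      apply: leq_trans idx_s' (d_mono _ _ _).
      by rewrite ltnS leqNgt; apply/negP => /d_mono; lia.
    exact: leq_trans le_i IHd.
  have [C CP] := st_fin s.+1.
  have [n nP] := finite_fibers_escape CP a_inj a_st.
  exists (n + i0.+1) => i le_i [s' [d_s' st_s' idx_s']].
  have [] := stay (i - i0.+1); rewrite subnKC; last by lia.
  move=> _ le_d; have : s' <= s by rewrite leqNgt; apply/negP => /d_mono; lia.
  by have := nP i.+1; lia.
have good_step i : n0 <= i -> idx (a i.+1) <= idx (a i) /\
    exists2 e, E e /\ low e = idx (a i.+1) & [/\ a i \in e, a i.+1 \in e,
      psi (a i) < psi (a i.+1) & forall z, z \in e -> U z -> psi z <= psi (a i.+1)].
  by move=> /good nb; have [/nb|] := stepP _ _ (aU _) (aU _) (a_step i).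
have [n1 idx_const] : exists n1, forall i, n1 <= i -> idx (a (n0 + i)) = idx (a (n0 + n1)).
  by apply: nonincreasing_stable => i; rewrite addnS; have [] := good_step _ (leq_addr i n0).
pose m := idx (a (n0 + n1)); pose b i := a (n0 + n1 + i).
have b_idx i : idx (b i) = m by rewrite /b -addnA idx_const ?leq_addr.
have bA i : A m (b i) by rewrite -(b_idx i); have [] := idxP _ (aU (n0 + n1 + i)).
apply: (no_seq m b bA) => i.
have [|_ [e [Ee low_e] [ae ae' lt_a max_a]]] := good_step (n0 + n1 + i).
  by rewrite -addnA leq_addr.
rewrite -addnS in low_e ae' lt_a max_a; rewrite -/(b _) b_idx in low_e.
have bU j : U (b j) by exact: aU.
have b_f j : f (b j) = phi m (b j) by rewrite /f b_idx.
have {}lt_a : psi (b i) < psi (b i.+1) by [].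
exists e => //; split=> //.
  rewrite -!b_f ltn_neqAle f_le ?b_idx ?(ltnW lt_a) //.
  rewrite andbT; apply/eqP => /f_inj; rewrite !b_idx => eq_b.
  by move: lt_a; rewrite eq_b ?ltnn.
(* Since [low e = m], a vertex of [e] in [A m] has index exactly [m], and there maximality for [psi]
   is maximality for [phi m]. *)
move=> z ze Az; have Uz : U z by exists m.
have [_ _ _ le_z] := owP _ _ Ee ze Uz; have [_ /(_ _ Az) z_le] := idxP _ Uz.
have idx_z : idx z = m by apply/eqP; rewrite eqn_leq z_le -low_e le_z.
by rewrite -b_f -{1}idx_z; apply: f_le; rewrite ?b_idx //; auto.
Qed.

Lemma tame_set0 (V : choiceType) (E : set {fset V}) (v : V) : tame E set0.
Proof.
exists (fun=> 0), (fun=> v); split=> // [a /(_ 0) //|w].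
by apply: sub_finite_set (finite_set0 _) => e [_ _ []].
Qed.

(** The new vertex gets the least label, so no step ends in it and a sequence lies in [A] from its
    second term on. It is charged only for its edges that miss [A]. *)
Lemma tame_setU1 (V : choiceType) (E : set {fset V}) (A : set V) (v : V) :
  finite_set [set e | [/\ E e, v \in e & forall w, w \in e -> ~ A w]]%classic ->
  tame E A -> tame E (v |` A)%classic.
Proof.
move=> v_fin tameA; have [Av|nAv] := pselect (A v).
  by rewrite (_ : (v |` A)%classic = A) //; apply/seteqP; split=> x; [case=> [->|]|right].
have [phi [own [phi_inj no_seq own_in own_fin]]] := tameA.
pose psi x := if x == v then 0 else (phi x).+1.
pose meets (e : {fset V}) := exists2 x, x \in e & A x.
exists psi, (fun e => if `[< meets e >] then own e else v); split.
- move=> x y [->|Ax] [->|Ay] //; rewrite /psi ?eqxx.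
  + by case: eqP => [->|].
  + by case: eqP => [->|].
  + case: (x =P v) => [eq_x|_]; first by rewrite eq_x in Ax.
    case: (y =P v) => [eq_y|_]; first by rewrite eq_y in Ay.
    by move=> [eq_phi]; apply: phi_inj.
- move=> a aU a_step.
  have a_psi i : psi (a i.+1) = (phi (a i.+1)).+1.
    by have [e _ [_ _]] := a_step i; rewrite [psi (a i.+1)]/psi; case: eqP.
  have aA i : A (a i.+1).
    by have [eq_v|//] := aU i.+1; have := a_psi i; rewrite /psi eq_v eqxx.
  apply: (no_seq (fun i => a i.+1)) => // i.
  have [e Ee [xe ye lt_a max_a]] := a_step i.+1; exists e => //; split=> //.
    by move: lt_a; rewrite !a_psi.
  move=> z ze Az; have := max_a z ze (or_intror Az); rewrite a_psi /psi.
  by case: eqP Az => [-> /nAv|].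
- move=> e x Ee xe [eq_v|Ax]; case: asboolP => [[y ye Ay]|no_A].
  + by have [? ?] := own_in _ _ Ee ye Ay; split=> //; right.
  + by rewrite -eq_v; split=> //; left.
  + by have [? ?] := own_in _ _ Ee ye Ay; split=> //; right.
  + by case: no_A; exists x.
- move=> w; have fin := conj (own_fin w) v_fin; rewrite -finite_setU in fin.
  apply: sub_finite_set fin => e [Ee]; case: asboolP => [me own_e _|no_A _ [x xe]]; first by left.
  case=> [eq_v|Ax]; last by case: no_A; exists x.
  by right; split; rewrite // -?eq_v // => y ye Ay; apply: no_A; exists y.
Qed.

(** Let [M] be the union of all tame sets. One tame set per vertex of [M] suffices to cover it, so
    [M] is a countable union and tame. A vertex outside [M] in only finitely many edges missing [M]
    could be added to [M]; hence a nonempty complement witnesses [property_C]. *)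
Lemma tame_setT (V : countType) (k : nat) (E : set {fset V}) (v0 : V) :
  uniform k E -> ~ property_C k E -> tame E [set: V]%classic.
Proof.
move=> unif noC; pose M v := exists A, tame E A /\ A v.
have /choice[G GP] : forall v, exists A, tame E A /\ (M v -> A v).
  move=> v; have [[A [tA Av]]|nM] := pselect (M v); first by exists A.
  by exists set0; split=> //; apply: tame_set0.
have tameM : tame E M.
  rewrite (_ : M = \bigcup_n oapp G set0 (choice.unpickle n))%classic.
    apply: tame_bigcup => n; case: (choice.unpickle n) => [v|]; last exact: tame_set0.
    by have [] := GP v.
  apply/seteqP; split=> [v Mv|v [n _]].
    by exists (choice.pickle v) => //; rewrite choice.pickleK /=; have [_ ] := GP v; apply.
  by case: (choice.unpickle n) => //= w Gv; exists (G w); have [] := GP w.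
suff allM : forall v, M v by rewrite (_ : setT = M) //; apply/seteqP; split=> v.
apply: contrapT => /existsNP[v nMv]; apply: noC.
exists [set x | ~ M x]%classic; split; first by exists v.
move=> w nMw fin; apply: nMw; exists (w |` M)%classic; split; last by left.
apply: tame_setU1 tameM; apply: sub_finite_set fin => e [Ee we eM]; split=> //.
rewrite -(unif e Ee) (_ : [fset x in e | x \in [set x | ~ M x]%classic]%fset = e) //.
apply/fsetP => x; rewrite !inE /=; case xe : (x \in e) => //=.
by apply/mem_set/eM.
Qed.

(** * Bijective labelings and the implication from (3) to (1) *)

Lemma bijective_compression (V : choiceType) (phi : V -> nat) :
  infinite_set [set: V]%classic -> injective phi ->
  exists2 psi : V -> nat, bijective psi & forall x y, phi x < phi y -> psi x < psi y.
Proof.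
move=> Vinf phi_inj; pose hit m := `[< exists v, phi v = m >].
(* [c m] counts the values of [phi] below [m], so [c (phi x)] is the rank of [phi x] among the
   values of [phi]. *)
pose c m := \sum_(i < m) hit i.
have cS m : c m.+1 = c m + hit m by rewrite /c big_ord_recr.
have c_mono m p : c m <= c (m + p).
  by elim: p => [|p IH]; rewrite ?addn0 // addnS cS; lia.
have hit_phi v : hit (phi v) by apply/asboolP; exists v.
have lt_c x y : phi x < phi y -> c (phi x) < c (phi y).
  by move=> lt_xy; rewrite -(subnKC lt_xy); apply: leq_trans (c_mono _ _); rewrite cS hit_phi addn1.
have c_unbounded n : exists m, n <= c m.
  elim: n => [|n [m le_m]]; first by exists 0.
  suff [v le_v] : exists v, m <= phi v.
    exists (phi v).+1; rewrite cS hit_phi addn1 ltnS.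
    by apply: leq_trans le_m _; rewrite -(subnKC le_v).
  apply: contrapT => /forallNP small; apply: Vinf.
  apply: (@finite_inj_bounded _ _ phi m) => [x y _ _|x _]; first exact: phi_inj.
  by have /negP := small x; rewrite -ltnNge; apply: ltnW.
exists (c \o phi) => //; have /choice[g gP] : forall n, exists v, c (phi v) = n.
  (* At the least [m.+1] where the count exceeds [n], the count has just risen from [n], so [m] is a
     value of [phi] of rank [n]. *)
  move=> n; have [[|m] lt_m m_min] := ex_least (c_unbounded n.+1).
    by rewrite /c big_ord0 in lt_m.
  have le_m : c m <= n by rewrite leqNgt; apply/negP => /m_min; rewrite ltnn.
  rewrite cS in lt_m; case hm : (hit m) lt_m => lt_m; last by lia.
  by have /asboolP[v eq_v] := hm; exists v; rewrite eq_v; lia.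
exists g => //= x; apply: phi_inj.
by case: (ltngtP (phi (g (c (phi x)))) (phi x)) => // /lt_c; rewrite gP ltnn.
Qed.

Lemma increasing_path_property_C (V : countType) (k : nat) (E : set {fset V}) :
  1 < k -> infinite_set [set: V]%classic -> uniform k E ->
  (forall phi : V -> nat, bijective phi -> increasing_path k E phi) ->
  property_C k E.
Proof.
move=> k_gt1 Vinf unif paths; apply: contrapT => noC.
have [v0 _] := infinite_setN0 Vinf.
have [phi [own [phi_inj no_seq _ _]]] := tame_setT v0 unif noC.
have [|psi psi_bij psi_mono] := @bijective_compression _ phi Vinf.
  by move=> x y; apply: phi_inj.
have [v [e [v_inj eP v_lt]]] := paths psi psi_bij.
have phi_lt i j : i < j -> phi (v i) < phi (v j).
  move=> lt_ij; have lt_psi : psi (v i) < psi (v j).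
    exact: (increasing_homo v_lt).
  case: (ltngtP (phi (v i)) (phi (v j))) => // [/psi_mono|eq_phi]; first by lia.
  by rewrite (phi_inj _ _ I I eq_phi) ltnn in lt_psi.
have phi_le i j : i <= j -> phi (v i) <= phi (v j).
  by rewrite leq_eqVlt => /orP[/eqP->|/phi_lt/ltnW].
(* Every [k.-1]-th vertex of the path is the last, hence largest, vertex of one edge and the first
   of the next. *)
apply: (no_seq (fun i => v (k.-1 * i))) => // i.
have [Ee e_def] := eP i; exists (e i) => //; rewrite e_def; split.
- by apply/imfsetP; exists (k.-1 * i) => //=; rewrite mem_iota; lia.
- by apply/imfsetP; exists (k.-1 * i.+1) => //=; rewrite mem_iota mulnS; lia.
- by apply: phi_lt; rewrite mulnS; lia.
- by move=> _ /imfsetP[j /= j_in ->] _; apply: phi_le; move: j_in; rewrite mem_iota mulnS; lia.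
Qed.

(** * Loose paths *)

Lemma path_edgeP (V : choiceType) (k : nat) (v : nat -> V) (i : nat) (w : V) :
  reflect (exists2 j, k.-1 * i <= j < k.-1 * i + k & w = v j) (w \in path_edge k v i).
Proof.
by apply: (iffP (imfsetP _ _ _ _)) => -[j j_in ->]; exists j => //; move: j_in; rewrite /= mem_iota.
Qed.

Definition on_path (V : choiceType) (x : V) (p : seq {fset V}) (w : V) : Prop :=
  w = x \/ exists2 e, e \in p & w \in e.

(** An inductive form of [loose_path] that forgets the numbering of the vertices: a new edge meets
    the earlier part only in the attaching vertex [z]. The two forms agree for [k]-uniform [F] with
    [1 < k]. *)
Inductive lpath (V : choiceType) (F : set {fset V}) (x : V) : V -> seq {fset V} -> Prop :=
| lpath_nil : lpath F x x [::]
| lpath_rcons z y p e : lpath F x z p -> F e -> z \in e -> y \in e -> z <> y ->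
    (forall w, w \in e -> on_path x p w -> w = z) -> lpath F x y (rcons p e).

Section LoosePaths.
Variables (V : choiceType) (F : set {fset V}).
Implicit Types (x y z w : V) (p q : seq {fset V}) (e : {fset V}).

Lemma lpathP x y p : lpath F x y p ->
  (p = [::] /\ y = x) \/ exists z q e, [/\ p = rcons q e, lpath F x z q, F e,
    [/\ z \in e, y \in e & z <> y] & forall w, w \in e -> on_path x q w -> w = z].
Proof.
by case=> [|z y' q e]; [left | move=> *; right; exists z, q, e].
Qed.

Lemma lpath_rconsP x y p e : lpath F x y (rcons p e) ->
  exists z, [/\ lpath F x z p, F e, [/\ z \in e, y \in e & z <> y]
    & forall w, w \in e -> on_path x p w -> w = z].
Proof.
case/lpathP=> [[]|[z [q [e' [/rcons_inj[-> ->] *]]]]]; last by exists z.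
by case: p.
Qed.

Lemma lpath_nilP x y : lpath F x y [::] -> y = x.
Proof. by case/lpathP=> [[]|[z [[|? ?] [? []]]]]. Qed.

Lemma on_path_rcons x p e w : on_path x (rcons p e) w <-> on_path x p w \/ w \in e.
Proof.
split=> [[->|[e']]|[[->|[e' e'p we']]|we]].
- by left; left.
- by rewrite mem_rcons in_cons => /orP[/eqP->|e'p] we'; [right|left; right; exists e'].
- by left.
- by right; exists e'; rewrite // mem_rcons in_cons e'p orbT.
- by right; exists e; rewrite // mem_rcons in_cons eqxx.
Qed.

Lemma lpath_loop x p : lpath F x x p -> p = [::].
Proof.
case/lpathP=> [[]//|[z [q [e [_ _ _ [_ xe zx] uniq_z]]]]].
by case: zx; rewrite (uniq_z x xe (or_introl erefl)).
Qed.

Lemma lpath1 x y e : F e -> x \in e -> y \in e -> x <> y -> lpath F x y [:: e].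
Proof.
move=> Fe xe ye xy; apply: (@lpath_rcons _ _ _ x y [::] e) => //; first exact: lpath_nil.
by move=> w _ [//|[]].
Qed.

(** Paths are built at their far end; this rule for the near end is what makes them reversible. *)
Lemma lpath_cons x z y p e : lpath F z y p -> F e -> x \in e -> z \in e -> x <> z ->
  (forall w, w \in e -> on_path z p w -> w = z) -> lpath F x y (e :: p).
Proof.
move=> path_p Fe xe ze xz; elim: path_p => [|u {}y {}p e' path_p IH Fe' ue' ye' uy u_uniq] z_uniq.
  exact: lpath1.
rewrite -rcons_cons; have on_p w : on_path z p w -> on_path z (rcons p e') w.
  by move=> wp; apply/on_path_rcons; left.
apply: (@lpath_rcons _ _ _ u) => //.
  by apply: IH => w we /on_p; apply: z_uniq.
have cross w : w \in e' -> w \in e -> w = u.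
  move=> we' we; apply: (u_uniq w we').
  by left; apply: (z_uniq w we); apply/on_path_rcons; right.
move=> w we' [eq_w|[e'']]; first by apply: cross; rewrite // eq_w.
rewrite in_cons => /orP[/eqP->|e''p] we''; first exact: cross.
by apply: u_uniq => //; right; exists e''.
Qed.

Lemma lpath_rev x y p : lpath F x y p -> lpath F y x (rev p).
Proof.
have on_rev q u w : on_path u (rev q) w -> w = u \/ on_path x q w.
  by move=> [->|[e]]; [left|rewrite mem_rev; right; right; exists e].
elim=> [|z {}y {}p e path_p IH Fe ze ye zy z_uniq]; first exact: lpath_nil.
rewrite rev_rcons; apply: lpath_cons IH Fe ye ze _ _ => [/esym //|w we].
by move=> /on_rev[//|]; apply: z_uniq.
Qed.

(** Cuts a path at a vertex. That [last e p = e] and [e \in p] says that the tail keeps the final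
    edge of [p], which lets it be told apart from a path through another edge. *)
Lemma lpath_suffix x y p z : lpath F x y p -> on_path x p z -> z <> y ->
  exists q e, [/\ lpath F z y (rcons q e), last e p = e, e \in p
    & forall w, on_path z (rcons q e) w -> on_path x p w].
Proof.
elim=> [[->|[]]//|u {}y {}p e path_p IH Fe ue ye uy u_uniq z_on zy].
have [ze|nze] := boolP (z \in e).
  exists [::], e; rewrite last_rcons mem_rcons in_cons eqxx; split=> //; first exact: lpath1.
  by move=> w /on_path_rcons[[->//|[]//]|we]; apply/on_path_rcons; right.
have z_p : on_path x p z by move/on_path_rcons: z_on => [//|]; rewrite (negPf nze).
have [q [e' [path_q _ _ sub_q]]] : exists q e', [/\ lpath F z u (rcons q e'),
    last e' p = e', e' \in p & forall w, on_path z (rcons q e') w -> on_path x p w].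
  by apply: IH => // eq_z; rewrite eq_z ue in nze.
exists (rcons q e'), e; rewrite last_rcons mem_rcons in_cons eqxx; split=> //.
  by apply: lpath_rcons path_q Fe ue ye uy _ => w we /sub_q; apply: u_uniq.
move=> w /on_path_rcons[/sub_q|] w_on; apply/on_path_rcons; [by left|by right].
Qed.

Variable k : nat.
Hypotheses (k_gt1 : 1 < k) (Funif : uniform k F).

Lemma loose_path_lpath x y p : loose_path k F x y p -> lpath F x y p.
Proof.
elim/last_ind: p y => [|p e IH] y [v [v_inj v0 v_end v_edge]].
  by rewrite -v_end muln0 v0; apply: lpath_nil.
rewrite size_rcons in v_inj v_end v_edge.
have [Fe e_def] := v_edge (size p) (leqnn _); rewrite nth_rcons ltnn eqxx in Fe e_def.
have p_edge i : i < size p -> F (nth fset0 p i) /\ nth fset0 p i = path_edge k v i.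
  by move=> lt_i; have := v_edge i (ltnW lt_i); rewrite nth_rcons lt_i.
apply: (@lpath_rcons _ _ _ (v (k.-1 * size p))) => //.
- apply: IH; exists v; split=> // i j; rewrite !inE => le_i le_j; apply: v_inj; rewrite inE mulnS; lia.
- by rewrite e_def; apply/path_edgeP; exists (k.-1 * size p) => //; lia.
- by rewrite e_def; apply/path_edgeP; exists (k.-1 * (size p).+1); [rewrite mulnS; lia | rewrite v_end].
- by rewrite -v_end => /v_inj; rewrite !inE mulnS; lia.
- move=> w; rewrite e_def => /path_edgeP[j j_in ->] w_on.
  (* The last edge uses indices from [k.-1 * size p] upwards, the earlier part indices up to it;
     injectivity leaves only that index in common. *)
  suff [i le_i eq_v] : exists2 i, i <= k.-1 * size p & v j = v i.
    have eq_j : j = i by apply: v_inj; rewrite // inE mulnS; lia.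
    by congr v; lia.
  case: w_on => [->|[e' /(nthP fset0)[i lt_i <-]]]; first by exists 0.
  have [_ ->] := p_edge i lt_i; move=> /path_edgeP[j' j'_in ->]; exists j' => //.
  have : k.-1 * i.+1 <= k.-1 * size p by rewrite leq_mul2l lt_i orbT.
  by rewrite mulnS; lia.
Qed.

Lemma lpath_loose_path x y p : lpath F x y p -> loose_path k F x y p.
Proof.
elim=> [|z {}y {}p e path_p [v [v_inj v0 v_end v_edge]] Fe ze ye zy z_uniq].
  by exists (fun=> x); split=> // i j; rewrite !inE muln0; lia.
set n := k.-1 * size p in v_inj v_end.
(* The numbering is continued after [z] by the other vertices of [e], with [y] placed last. *)
pose s := rcons (enum_fset (e `\ z `\ y)%fset) y.
have mem_s w : (w \in s) = (w != z) && (w \in e).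
  rewrite mem_rcons in_cons; have [->|wy] := eqVneq w y; first by rewrite ye andbT; apply/esym/eqP/nesym.
  by rewrite -[w \in enum_fset _]/(w \in (e `\ z `\ y)%fset) !in_fsetD1 wy.
have s_uniq : uniq s.
  rewrite rcons_uniq fset_uniq andbT -[y \in enum_fset _]/(y \in (e `\ z `\ y)%fset).
  by rewrite !in_fsetD1 eqxx.
have s_size : size s = k.-1.
  rewrite -(Funif Fe) size_rcons -[size _]/(#|` e `\ z `\ y|)%fset.
  rewrite [in RHS](cardfsD1 z) ze [in RHS](cardfsD1 y) in_fsetD1 ye.
  by have -> : y != z by apply/eqP/nesym.
have v_on i : i <= n -> on_path x p (v i).
  move=> le_i; have [p0|p_gt0] := posnP (size p).
    by left; move: le_i; rewrite /n p0 muln0 leqn0 => /eqP->.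
  (* The cap is for [i = n], which belongs to the last edge although the quotient is [size p]. *)
  right; pose j := minn (i %/ k.-1) (size p).-1.
  have lt_j : j < size p by rewrite /j; lia.
  exists (nth fset0 p j); first exact: mem_nth.
  have [_ ->] := v_edge j lt_j; apply/path_edgeP; exists i => //.
  have le_div := leq_trunc_div i k.-1.
  have lt_div := @ltn_ceil i k.-1 (ltac:(lia)).
  rewrite /j; have [le_m|lt_m] := leqP (i %/ k.-1) (size p).-1; first by nia.
  by rewrite /n in le_i; nia.
pose u j := if j <= n then v j else nth z s (j - n.+1).
have u_new j : n < j < n + k -> u j \in s.
  move=> j_in; rewrite /u leqNgt (_ : n < j) /=; last by lia.
  by apply: mem_nth; rewrite s_size; lia.
have u_edge i : i < size p -> path_edge k u i = path_edge k v i.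
  move=> lt_i; have le_n : k.-1 * i + k <= n.+1.
    by have : k.-1 * i.+1 <= n; [rewrite leq_mul2l lt_i orbT | rewrite mulnS; lia].
  by apply/fsetP => w; apply/path_edgeP/path_edgeP => -[j j_in ->]; exists j;
    rewrite // /u; case: leqP => //; lia.
have u_last : path_edge k u (size p) = e.
  apply/fsetP => w; apply/path_edgeP/idP => [[j j_in ->]|we].
    have [eq_j|ne_j] := eqVneq j n; first by rewrite /u eq_j leqnn v_end.
    by have := @u_new j; rewrite mem_s -/n in j_in *; lia.
  rewrite -/n; have [->|wz] := eqVneq w z; first by exists n; [lia|rewrite /u leqnn].
  have ws : w \in s by rewrite mem_s wz.
  have := ws; rewrite -index_mem s_size => lt_w; exists (n.+1 + index w s); first by lia.
  by rewrite /u leqNgt ltn_addr //= addKn nth_index.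
have u_sep i j : i <= n -> n < j < n + k -> u i <> u j.
  move=> le_i j_in; have := u_new j j_in; rewrite mem_s => /andP[uj_z uj_e] eq_u.
  case/eqP: uj_z; apply: (z_uniq _ uj_e); rewrite -eq_u /u le_i; exact: v_on.
exists u; rewrite size_rcons mulnS -/n; split.
- move=> i j; rewrite !inE => le_i le_j.
  have [i_n|n_i] := leqP i n; have [j_n|n_j] := leqP j n.
  + by rewrite /u i_n j_n; apply: v_inj.
  + by move/u_sep; case=> //; lia.
  + by move/esym/u_sep; case=> //; lia.
  + rewrite /u ifN -?ltnNge // ifN -?ltnNge // => /eqP; rewrite nth_uniq ?s_size //; [|lia|lia].
    by move/eqP; lia.
- by rewrite /u.
- by rewrite /u leqNgt (_ : n < k.-1 + n) /=; [rewrite nth_rcons | lia];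
    rewrite (_ : k.-1 + n - n.+1 = size (enum_fset (e `\ z `\ y)%fset)) ?ltnn ?eqxx //;
    move: s_size; rewrite size_rcons; lia.
- move=> i; rewrite ltnS leq_eqVlt => /orP[/eqP->|lt_i].
    by rewrite nth_rcons ltnn eqxx u_last.
  by rewrite nth_rcons lt_i u_edge //; apply: v_edge.
Qed.

End LoosePaths.

(** * Breadth-first trees *)

(** [depth] measures a path from [x] to the root; reversal and uniqueness identify it with the given
    path from the root. *)
Lemma depth_lpath (V : choiceType) (k : nat) (W : set V) (F : set {fset V})
    (r x : V) (p : seq {fset V}) :
  1 < k -> branching_tree k W F r -> W x -> lpath F r x p -> depth k F r x = size p.
Proof.
move=> k_gt1 [Wr [Funif _] Fpath _ _] Wx path_p.
have [q [_ q_uniq]] := Fpath _ _ Wx Wr.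
have loose_p := lpath_loose_path k_gt1 Funif (lpath_rev path_p).
rewrite -(size_rev p) -(q_uniq _ loose_p) /depth; congr size.
by case: xgetP => [q' _ /= path_q|/(_ (rev p)) //]; rewrite (q_uniq _ path_q).
Qed.

Section BreadthFirst.
Variables (V : choiceType) (k : nat) (f : nat -> V).
Hypotheses (k_gt1 : 1 < k) (f_inj : injective f).

(* Breadth-first numbering of the (k-1)-branching tree: vertex [i] is joined to
   its children [(k-1)i+1, ..., (k-1)(i+1)] by the edge [bfs_edge i]. *)
Definition bfs_edge (i : nat) : {fset V} :=
  [fset f j | j in i :: iota (k.-1 * i).+1 k.-1]%fset.

Definition bfs_edges : set {fset V} := range bfs_edge.

Let child (i j : nat) := k.-1 * i < j <= k.-1 * i.+1.

Lemma bfs_edgeP i j : reflect (j = i \/ child i j) (f j \in bfs_edge i).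
Proof.
have mem_i : (j \in i :: iota (k.-1 * i).+1 k.-1) = (j == i) || child i j.
  by rewrite in_cons mem_iota /child mulnS; congr orb; lia.
rewrite mem_imfset //= mem_i.
by apply: (iffP orP) => -[/eqP|]; auto.
Qed.

Lemma bfs_edge_vertex i w : w \in bfs_edge i -> exists j, w = f j.
Proof. by case/imfsetP=> j _ ->; exists j. Qed.

Lemma child_gt i j : child i j -> i < j.
Proof. by rewrite /child; have : 1 * i <= k.-1 * i; [rewrite leq_mul2r; lia|lia]. Qed.

Lemma child_parent_mono i i' j j' : child i j -> child i' j' -> j <= j' -> i <= i'.
Proof.
rewrite /child => ci ci' le_j; rewrite leqNgt; apply/negP => lt_i.
have : k.-1 * i'.+1 <= k.-1 * i by rewrite leq_mul2l lt_i orbT.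
by lia.
Qed.

Lemma child_parent_uniq i i' j : child i j -> child i' j -> i = i'.
Proof.
by move=> ci ci'; apply/eqP; rewrite eqn_leq (child_parent_mono ci ci') // (child_parent_mono ci' ci).
Qed.

Lemma parent_ex j : 0 < j -> exists i, child i j.
Proof.
move=> j_gt0; exists (j.-1 %/ k.-1); rewrite /child.
have := leq_trunc_div j.-1 k.-1; have := @ltn_ceil j.-1 k.-1 (ltac:(lia)).
by rewrite ![k.-1 * _]mulnC; lia.
Qed.

Lemma bfs_edge_inj : injective bfs_edge.
Proof.
move=> i j eq_ij.
have /bfs_edgeP : f i \in bfs_edge j by rewrite -eq_ij; apply/bfs_edgeP; left.
have /bfs_edgeP : f j \in bfs_edge i by rewrite eq_ij; apply/bfs_edgeP; left.
by move=> [//|/child_gt lt_ij] [//|/child_gt]; lia.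
Qed.

Local Notation F := bfs_edges.

(** Such a path enters [y] from a child. The edge before cannot be the same edge, so it enters that
    child from one of its own children, and so on back to the start, which is thus a descendant of
    [y]. *)
Lemma lpath_descends x y p : lpath F (f x) (f y) (rcons p (bfs_edge y)) -> k.-1 * y < x.
Proof.
elim/last_ind: p y => [|p e IH] y /lpath_rconsP[z [path_p _ [zy _ nzy] z_uniq]].
  have eq_z := lpath_nilP path_p; rewrite eq_z in zy nzy.
  by have /bfs_edgeP[eq_xy|/andP[]//] := zy; rewrite eq_xy in nzy.
have [b eq_z] := bfs_edge_vertex zy; subst z.
have cb : child y b by have /bfs_edgeP[eq_b|//] := zy; rewrite eq_b in nzy.
have [_ [_ [c _ eq_e] [_ be _] _]] := lpath_rconsP path_p.
subst e.
have /bfs_edgeP[eq_b|cb'] := be; last first.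
  have eq_c := child_parent_uniq cb' cb; case: nzy; apply/esym/z_uniq.
    by apply/bfs_edgeP; left.
  by apply/on_path_rcons; right; rewrite eq_c; apply/bfs_edgeP; left.
rewrite -eq_b in path_p; apply: leq_ltn_trans (IH _ path_p).
by rewrite leq_mul2l (ltnW (child_gt cb)) orbT.
Qed.

(** A path from a smaller number cannot enter [y], or a sibling of [y], from below by
    [lpath_descends]. Hence it uses the parent edge, either starting at a sibling or passing through
    the parent; [x] and [i] alone decide which. *)
Lemma lpath_last_edge x y p : x < y -> lpath F (f x) (f y) p ->
  exists i q, [/\ child i y, p = rcons q (bfs_edge i) &
    (k.-1 * i < x /\ q = [::]) \/ (x <= k.-1 * i /\ lpath F (f x) (f i) q)].
Proof.
move=> lt_xy path_p.
have [[_ /f_inj eq_xy]|[z [q [e [eq_p path_q [c _ eq_e] [ze ye nzy] z_uniq]]]]] := lpathP path_p.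
  by rewrite eq_xy ltnn in lt_xy.
subst e.
have le_mul i : i <= k.-1 * i by rewrite -{1}[i]mul1n leq_mul2r; lia.
have cy : child c y.
  have /bfs_edgeP[eq_y|//] := ye; rewrite eq_p -eq_y in path_p.
  by have := lpath_descends path_p; have := le_mul y; lia.
exists c, q; split=> //.
have [b eq_z] := bfs_edge_vertex ze; subst z.
have /bfs_edgeP[eq_b|cb] := ze.
  right; rewrite -eq_b; split=> //; rewrite leqNgt; apply/negP => lt_x.
  have x_on : on_path (f x) q (f x) by left.
  have /f_inj eq_x : f x = f b.
    by apply: z_uniq x_on; apply/bfs_edgeP; right; move: cy; rewrite /child; lia.
  by have := le_mul b; lia.
left; case/lastP: q => [|q e] in path_q z_uniq eq_p *.
  by have /f_inj eq_b := lpath_nilP path_q; rewrite -eq_b; have /andP[] := cb.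
have [_ [_ [c' _ eq_e] [_ be _] _]] := lpath_rconsP path_q.
subst e.
have /bfs_edgeP[eq_b|cb'] := be; last first.
  have eq_c := child_parent_uniq cb' cb; case: nzy; apply/esym/z_uniq => //.
  by apply/on_path_rcons; right; rewrite eq_c.
rewrite -eq_b in path_q; have := lpath_descends path_q.
have : k.-1 * c.+1 <= k.-1 * b by rewrite leq_mul2l (child_gt cb) orbT.
by move: cy; rewrite /child; lia.
Qed.

(** Induction on the larger endpoint, moved to the end by reversal: its last edge is forced, and
    what remains ends at the parent. *)
Lemma bfs_lpath_uniq x y p q : lpath F (f x) (f y) p -> lpath F (f x) (f y) q -> p = q.
Proof.
have [n] := ubnP (maxn x y); elim: n => // n IH in x y p q *.
move=> le_n path_p path_q.
wlog lt_xy : x y p q le_n path_p path_q / x < y => [wlog_lt|].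
  have [lt_xy|lt_yx|eq_xy] := ltngtP x y.
  - exact: (wlog_lt x y).
  - apply: (can_inj revK); apply: (wlog_lt y x) => //; first by rewrite maxnC.
      exact: lpath_rev.
    exact: lpath_rev.
  - by rewrite eq_xy in path_p path_q; rewrite (lpath_loop path_p) (lpath_loop path_q).
have [i [p' [ci eq_p p'P]]] := lpath_last_edge lt_xy path_p.
have [j [q' [cj eq_q q'P]]] := lpath_last_edge lt_xy path_q.
rewrite {}eq_p {}eq_q {path_p path_q}.
have eq_ij := child_parent_uniq ci cj; rewrite -eq_ij in q'P *; congr rcons.
case: p'P q'P => [[lt_x ->]|[le_x path_p]] [[lt_x' ->]|[le_x' path_q]] //; [lia|lia|].
by apply: IH path_p path_q; have := child_gt ci; lia.
Qed.

Lemma bfs_lpath_ex x y : exists p, lpath F (f x) (f y) p.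
Proof.
(* The bound on the edges is what makes the next edge new: edges numbered below [i] meet
   [bfs_edge i] at most in [f i]. *)
suff low a b : a <= b -> exists2 p, lpath F (f a) (f b) p &
    forall e, e \in p -> exists2 j, e = bfs_edge j & k.-1 * j < b.
  have [/low[p path_p _]|/ltnW/low[p path_p _]] := leqP x y; first by exists p.
  by exists (rev p); apply: lpath_rev.
have [n] := ubnP b; elim: n => // n IH in a b *; rewrite ltnS => le_n.
rewrite leq_eqVlt => /orP[/eqP->|lt_ab]; first by exists [::]; first exact: lpath_nil.
have [i ci] := @parent_ex b (leq_ltn_trans (leq0n a) lt_ab); have lt_ib := child_gt ci.
have Fi : F (bfs_edge i) by exists i.
have bi : f b \in bfs_edge i by apply/bfs_edgeP; right.
have ii : f i \in bfs_edge i by apply/bfs_edgeP; left.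
have [ai|nai] := boolP (f a \in bfs_edge i).
  exists [:: bfs_edge i].
    by apply: lpath1 => // /f_inj eq_ab; rewrite eq_ab ltnn in lt_ab.
  by move=> e; rewrite inE => /eqP->; exists i => //; have /andP[] := ci.
have a_le : a <= k.-1 * i.
  rewrite leqNgt; apply: contra nai => lt_a; apply/bfs_edgeP; right.
  by move: ci; rewrite /child; lia.
have [p path_p p_low] : exists2 p, lpath F (f a) (f i) p &
    forall e, e \in p -> exists2 j, e = bfs_edge j & j < i.
  have lt_i j : k.-1 * j < k.-1 * i -> j < i by rewrite ltn_mul2l => /andP[].
  have [le_ai|lt_ia] := leqP a i.
    have [|p path_p p_low] := IH a i _ le_ai; first lia.
    exists p => // e /p_low[j -> lt_j]; exists j => //; apply: lt_i.
    by apply: leq_trans lt_j _; rewrite -{1}[i]mul1n leq_mul2r; lia.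
  have [|p path_p p_low] := IH i a _ (ltnW lt_ia); first lia.
  exists (rev p); first exact: lpath_rev.
  by move=> e; rewrite mem_rev => /p_low[j -> lt_j]; exists j => //; apply: lt_i; lia.
exists (rcons p (bfs_edge i)).
  apply: (@lpath_rcons _ _ _ (f i)) => //.
    by move=> /f_inj eq_ib; rewrite eq_ib ltnn in lt_ib.
  move=> w wi [eq_w|[e /p_low[j -> lt_j] wj]]; first by rewrite -eq_w wi in nai.
  have [c eq_w] := bfs_edge_vertex wi; subst w.
  have /bfs_edgeP[-> //|ci'] := wi; have /bfs_edgeP[eq_c|cj] := wj.
    by have := child_gt ci'; lia.
  by have := child_parent_uniq ci' cj; lia.
move=> e; rewrite mem_rcons in_cons => /orP[/eqP->|/p_low[j -> lt_j]].
  by exists i => //; have /andP[] := ci.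
exists j => //; have : k.-1 * j <= k.-1 * i by rewrite leq_mul2l (ltnW lt_j) orbT.
by have /andP[] := ci; lia.
Qed.

(** Passing to parents preserves the order of the numbering, so the last edges can be removed from
    both paths together. *)
Lemma bfs_size_mono x y p q : x <= y ->
  lpath F (f 0) (f x) p -> lpath F (f 0) (f y) q -> size p <= size q.
Proof.
have [n] := ubnP y; elim: n => // n IH in x y p q *; rewrite ltnS => le_n le_xy.
have [->|x_gt0 path_p path_q] := posnP x; first by move=> /lpath_loop->.
have [i [p' [ci -> [[] //|[_ path_p']]]]] := lpath_last_edge x_gt0 path_p.
have [j [q' [cj -> [[] //|[_ path_q']]]]] := lpath_last_edge (leq_trans x_gt0 le_xy) path_q.
rewrite !size_rcons ltnS; apply: IH path_p' path_q'; first by have := child_gt cj; lia.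
exact: child_parent_mono ci cj le_xy.
Qed.

Lemma bfs_tree : uniform k F -> branching_tree k (range f) F (f 0).
Proof.
move=> Funif; split; first by exists 0.
- split=> // _ [i _ <-] w /= wi; have [j ->] := bfs_edge_vertex wi; by exists j.
- move=> _ _ [x _ <-] [y _ <-]; have [p path_p] := bfs_lpath_ex x y.
  exists p; split; first exact: lpath_loose_path.
  move=> q /(loose_path_lpath k_gt1) path_q; exact: bfs_lpath_uniq path_p path_q.
- rewrite /has_degree (_ : [set e | F e /\ f 0 \in e] = [set bfs_edge 0])%classic.
    exact: card_set1.
  apply/seteqP; split=> [_ [[i _ <-] /bfs_edgeP[<-//|/andP[]//]]|_ ->].
  by split; [exists 0|apply/bfs_edgeP; left].
- move=> _ [[|y] _ <-]; first by rewrite eqxx.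
  move=> _; have [i ci] := @parent_ex y.+1 isT.
  rewrite /has_degree (_ : [set e | F e /\ f y.+1 \in e] =
    [set` [fset bfs_edge i; bfs_edge y.+1]%fset])%classic.
    apply/card_eq_fsetP; rewrite cardfs2 (_ : _ != _) //; apply/eqP => /bfs_edge_inj eq_i.
    by have := child_gt ci; rewrite eq_i ltnn.
  apply/seteqP; split=> [_ [[j _ <-] /bfs_edgeP[<-|cj]]|e] /=; rewrite !inE.
  + by rewrite eqxx orbT.
  + by rewrite (child_parent_uniq cj ci) eqxx.
  + by move=> /orP[]/eqP->; split; [exists i|apply/bfs_edgeP; right|exists y.+1|apply/bfs_edgeP; left].
Qed.

(** Smaller depth implies a smaller breadth-first number, so labels that increase along the
    numbering are enough. *)
Lemma bfs_increasing_tree (E : set {fset V}) (phi : V -> nat) :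
  uniform k E -> (forall i, E (bfs_edge i)) ->
  (forall i, phi (f i) < phi (f i.+1)) -> increasing_tree k E phi.
Proof.
move=> unif E_edge phi_lt; have sub : (F `<=` E)%classic by move=> _ [i _ <-].
have tree : branching_tree k (range f) F (f 0) by apply: bfs_tree => e /sub; apply: unif.
exists (range f), F, (f 0); split=> // _ _ [x _ <-] [y _ <-].
have [p path_p] := bfs_lpath_ex 0 x; have [q path_q] := bfs_lpath_ex 0 y.
rewrite (depth_lpath k_gt1 tree _ path_p); last by exists x.
rewrite (depth_lpath k_gt1 tree _ path_q); last by exists y.
have [lt_xy _|le_yx] := ltnP x y; last by have := bfs_size_mono le_yx path_q path_p; lia.
exact: (increasing_homo phi_lt).
Qed.

End BreadthFirst.

(** * Increasing paths in trees, and growing a tree *)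

Lemma fset_sort (V : choiceType) (phi : V -> nat) (e : {fset V}) : injective phi ->
  exists s : seq V, [/\ s =i e, size s = #|` e| & sorted ltn (map phi s)].
Proof.
move=> phi_inj; exists (sort (relpre phi leq) (enum_fset e)); split.
- by move=> x; rewrite mem_sort.
- by rewrite size_sort.
- rewrite ltn_sorted_uniq_leq (map_inj_uniq phi_inj) sort_uniq fset_uniq sorted_map.
  by apply: sort_sorted => x y; apply: leq_total.
Qed.

(** Each edge is listed by increasing label. As [a i.+1] is the largest vertex of [e i] and the
    smallest of [e i.+1], consecutive lists overlap in it and glue to a path. *)
Lemma chain_increasing_path (V : choiceType) (k : nat) (E : set {fset V}) (phi : V -> nat)
    (a : nat -> V) (e : nat -> {fset V}) :
  1 < k -> injective phi -> uniform k E -> (forall i, E (e i)) ->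
  (forall i, a i \in e i) -> (forall i, a i.+1 \in e i) ->
  (forall i w, w \in e i -> phi (a i) <= phi w <= phi (a i.+1)) ->
  increasing_path k E phi.
Proof.
move=> k_gt1 phi_inj unif Ee ae ae' a_bound.
have /choice[s sP] := fun i => fset_sort (e i) phi_inj.
have s_size i : size (s i) = k by have [_ -> _] := sP i; apply: unif.
have s_mem i w : (w \in s i) = (w \in e i) by have [-> _ _] := sP i.
have s_lt i t t' : t < t' < k -> phi (nth (a 0) (s i) t) < phi (nth (a 0) (s i) t').
  have [_ _ sorted_s] := sP i; move=> /andP[lt_t lt_t'].
  rewrite -!(nth_map _ 0 phi) ?s_size ?(ltn_trans lt_t) //.
  apply: (sorted_ltn_nth ltn_trans) => //; rewrite inE size_map s_size //.
  exact: ltn_trans lt_t'.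
have s_first i : nth (a 0) (s i) 0 = a i.
  have ai : a i \in s i by rewrite s_mem.
  have s0 : nth (a 0) (s i) 0 \in e i by rewrite -s_mem mem_nth // s_size; lia.
  have [i0|i_gt0] := posnP (index (a i) (s i)); first by rewrite -i0 nth_index.
  have lt_i : index (a i) (s i) < k by rewrite -[X in _ < X](s_size i) index_mem.
  have := s_lt i 0 (index (a i) (s i)); rewrite i_gt0 lt_i nth_index //.
  by have := a_bound i _ s0; lia.
have s_last i : nth (a 0) (s i) k.-1 = a i.+1.
  have ai : a i.+1 \in s i by rewrite s_mem.
  have sl : nth (a 0) (s i) k.-1 \in e i by rewrite -s_mem mem_nth // s_size; lia.
  have lt_i : index (a i.+1) (s i) < k by rewrite -[X in _ < X](s_size i) index_mem.
  have [il|i_lt] := eqVneq (index (a i.+1) (s i)) k.-1; first by rewrite -il nth_index.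
  have := s_lt i (index (a i.+1) (s i)) k.-1; rewrite nth_index //.
  by have := a_bound i _ sl; lia.
(* The last vertex of an edge is read as the first vertex of the next one; [vE] recovers it for
   [t = k.-1]. *)
pose v j := nth (a 0) (s (j %/ k.-1)) (j %% k.-1).
have k1_gt0 : 0 < k.-1 by lia.
have vE i t : t < k -> v (k.-1 * i + t) = nth (a 0) (s i) t.
  move=> lt_t; have [lt_t'|ge_t] := ltnP t k.-1.
    by rewrite /v mulnC divnMDl // divn_small // addn0 modnMDl modn_small.
  have -> : t = k.-1 by lia.
  by rewrite -mulnSr /v mulKn // modnMr s_first s_last.
have v_lt j : phi (v j) < phi (v j.+1).
  rewrite (divn_eq j k.-1) mulnC -addnS; have lt_m := ltn_pmod j k1_gt0.
  by rewrite !vE ?s_lt //; lia.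
exists v, e; split=> [|i|//]; first exact: increasing_inj v_lt.
split=> //; apply/fsetP => w; rewrite -s_mem.
apply/idP/path_edgeP => [ws|[j /andP[le_j lt_j] ->]].
  have lt_i := ws; rewrite -index_mem s_size in lt_i.
  by exists (k.-1 * i + index w (s i)); [lia|rewrite vE // nth_index].
by rewrite -(subnKC le_j) vE ?mem_nth ?s_size //; lia.
Qed.

Lemma has_degree1_ex (V : choiceType) (F : set {fset V}) (x : V) :
  has_degree F x 1 -> exists2 e, F e & x \in e.
Proof.
move=> deg; apply: contrapT => no_e; suff S0 : [set e | F e /\ x \in e]%classic = set0.
  by move: deg; rewrite /has_degree S0 card_eq_sym card_eq0 => /eqP/seteqP[/(_ 0)/(_ isT)].
by apply/seteqP; split=> [e [Fe xe]|//]; apply: no_e; exists e.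
Qed.

Lemma has_degree2_ex (V : choiceType) (F : set {fset V}) (x : V) (e0 : {fset V}) :
  has_degree F x 2 -> exists e, [/\ F e, x \in e & e <> e0].
Proof.
move=> deg; apply: contrapT => no_e.
have sub : ([set e | F e /\ x \in e] `<=` [set e0])%classic.
  by move=> e [Fe xe]; apply: contrapT => ne; apply: no_e; exists e.
have := subset_card_le sub; rewrite (card_le_eql deg) (card_le_eqr card_set1).
by rewrite card_le_II.
Qed.

(** The state keeps the path from the root along with the current vertex, so that uniqueness of
    paths shows the other vertices of the next edge to be one level deeper, hence larger in
    label. *)
Lemma increasing_tree_path (V : choiceType) (k : nat) (E : set {fset V}) (phi : V -> nat) :
  1 < k -> injective phi -> uniform k E -> increasing_tree k E phi -> increasing_path k E phi.
Proof.
move=> k_gt1 phi_inj unif [W [F [r [FE tree phi_mono]]]].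
have [Wr [Funif FW] Fpath deg_r deg_x] := tree.
pose next (S S' : V * seq {fset V}) (e : {fset V}) := [/\ F e, S.1 \in e, S'.1 \in e
  & forall w, w \in e -> phi S.1 <= phi w <= phi S'.1].
have step (S : {S : V * seq {fset V} | W S.1 /\ lpath F r S.1 S.2}) :
    exists Se : {S : V * seq {fset V} | W S.1 /\ lpath F r S.1 S.2} * {fset V},
      next (sval S) (sval Se.1) Se.2.
  case: S => -[x p] /= [Wx path_p].
  (* The new edge differs from the final edge of [p]; the condition is vacuous at the root, where
     [p] is empty. *)
  have [e [Fe xe e_new]] : exists e, [/\ F e, x \in e & forall e', last e' p = e' -> e' \in p -> e' <> e].
    case/lastP: p path_p => [/lpath_nilP eq_x|p e0 path_p].
      by have [e Fe re] := has_degree1_ex deg_r; exists e; rewrite eq_x.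
    have x_r : x != r by apply/eqP => eq_x; rewrite eq_x in path_p; have := lpath_loop path_p; case: (p).
    have [e [Fe xe ne]] := has_degree2_ex e0 (deg_x x Wx x_r).
    by exists e; split=> // e'; rewrite last_rcons => <- _ /esym.
  (* Otherwise the tail of [p] from [w] to [x] and the single edge [e] would be two paths with
     different last edges. *)
  have only_x w : w \in e -> on_path r p w -> w = x.
    move=> we w_on; apply: contrapT => wx.
    have [q [e' [path_q last_p e'p _]]] := lpath_suffix path_p w_on wx.
    apply: (e_new e' last_p e'p); have Ww : W w by apply: (FW e Fe).
    have [q0 [_ q0_uniq]] := Fpath _ _ Ww Wx.
    have eq1 := q0_uniq _ (lpath_loose_path k_gt1 Funif path_q).
    have eq2 := q0_uniq _ (lpath_loose_path k_gt1 Funif (lpath1 Fe we xe wx)).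
    by move: eq1; rewrite eq2 => /(congr1 (last e)); rewrite last_rcons.
  have path_w w : w \in e -> x <> w -> lpath F r w (rcons p e).
    by move=> we xw; apply: lpath_rcons path_p Fe xe we xw only_x.
  have phi_w w : w \in e -> x <> w -> phi x < phi w.
    move=> we xw; have Ww : W w by apply: (FW e Fe).
    apply: phi_mono => //; rewrite (depth_lpath k_gt1 tree Wx path_p).
    by rewrite (depth_lpath k_gt1 tree Ww (path_w w we xw)) size_rcons.
  case: (arg_maxnP (P := predT) (i0 := [` xe]%fset) (fun z : e => phi (val z))) => // y _ y_max.
  have max_y w : w \in e -> phi w <= phi (val y) by move=> we; apply: (y_max [` we]%fset).
  have x_y : x <> val y.
    have /fset0Pn[w] : (e `\ x)%fset != fset0.
      by rewrite -cardfs_gt0; have := Funif e Fe; rewrite (cardfsD1 x) xe; lia.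
    rewrite in_fsetD1 => /andP[wx we] eq_x; have := max_y w we; rewrite -eq_x leqNgt.
    by rewrite phi_w //; apply/eqP; rewrite eq_sym.
  have ye := valP y.
  exists (exist _ (val y, rcons p e) (conj (FW e Fe _ ye) (path_w _ ye x_y)), e).
  split=> // w we /=; rewrite max_y // andbT.
  by have [->//|/eqP wx] := eqVneq w x; apply/ltnW/phi_w => // /esym.
have [g gP] := choice step.
pose S0 : {S : V * seq {fset V} | W S.1 /\ lpath F r S.1 S.2} :=
  exist _ (r, [::]) (conj Wr (lpath_nil F r)).
pose S i := iter i (fun T => (g T).1) S0.
apply: (@chain_increasing_path _ k E phi (fun i => (sval (S i)).1) (fun i => (g (S i)).2)) => // i.
- by have [/FE] := gP (S i).
- by have [] := gP (S i).
- by have [] := gP (S i).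
- by have [_ _ _] := gP (S i).
Qed.

Lemma property_C_increasing_tree (V : choiceType) (k : nat) (E : set {fset V})
    (phi : V -> nat) :
  1 < k -> injective phi -> uniform k E -> simple E -> property_C k E ->
  increasing_tree k E phi.
Proof.
move=> k_gt1 phi_inj unif simp [V' [[v0 V'v0] V'inf]].
(* By simplicity, distinct edges through [x] share no other vertex, so only finitely many of them
   contain another vertex with label at most [N]. *)
have far x N : V' x -> exists s : seq V, [/\ size s = k.-1, forall w, w \in s -> V' w /\ N < phi w,
    sorted ltn (map phi s) & E [fset w in x :: s]%fset].
  move=> V'x; suff [e [Ee xe eV' e_far]] : exists e, [/\ E e, x \in e,
      forall w, w \in e -> V' w & forall w, w \in e -> w <> x -> N < phi w].
    have [s [s_mem s_size s_sorted]] := fset_sort (e `\ x)%fset phi_inj.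
    exists s; split=> //.
    - by rewrite s_size -(unif e Ee) (cardfsD1 x e) xe.
    - by move=> w; rewrite s_mem in_fsetD1 => /andP[/eqP wx we]; split; auto.
    - rewrite (_ : [fset w in x :: s]%fset = e) //; apply/fsetP => w.
      by rewrite !inE s_mem in_fsetD1; have [->|] := eqVneq w x.
  apply: contrapT => no_e; apply: (V'inf x V'x).
  have near e : [/\ E e, x \in e & k <= #|` [fset w in e | w \in V']%fset|] ->
      exists w, [/\ w \in e, w <> x & phi w <= N].
    move=> [Ee xe le_k]; apply: contrapT => no_w; apply: no_e; exists e; split=> // w we.
      have eq_e : [fset w in e | w \in V']%fset = e.
        apply/eqP; rewrite eqEfcard (unif e Ee) le_k andbT.
        by apply/fsubsetP => z; rewrite !inE => /andP[].
      by move: we; rewrite -{1}eq_e !inE => /andP[_ /set_mem].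
    by move=> wx; rewrite ltnNge; apply/negP => le_w; apply: no_w; exists w.
  have /choice[h hP] : forall e, exists w, [/\ E e, x \in e
      & k <= #|` [fset w in e | w \in V']%fset|] -> [/\ w \in e, w <> x & phi w <= N].
    move=> e; have [/near[w wP]|no] := pselect ([/\ E e, x \in e
      & k <= #|` [fset w in e | w \in V']%fset|]); first by exists w.
    by exists x => /no.
  apply: (@finite_inj_bounded _ _ (fun e => phi (h e)) N) => [e e' eP e'P /phi_inj eq_h|e /hP[]//].
  have [he hx _] := hP e eP; have [he' _ _] := hP e' e'P; rewrite -eq_h in he'.
  have [Ee xe _] := eP; have [Ee' xe' _] := e'P.
  by apply: (simp (h e) x) => //; apply/eqP.
have /choice[g gP] : forall xN : V * nat, exists s : seq V, V' xN.1 -> [/\ size s = k.-1,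
    forall w, w \in s -> V' w /\ xN.2 < phi w, sorted ltn (map phi s)
    & E [fset w in xN.1 :: s]%fset].
  move=> [x N]; have [/(far x N)[s sP]|no] := pselect (V' x); first by exists s.
  by exists [::] => /no.
(* [S n] lists the first [k.-1 * n + 1] vertices of the tree; round [m] appends the children of
   vertex [m], all labeled above everything listed so far. *)
pose S := fix S n := if n is m.+1 then
  S m ++ g (nth v0 (S m) m, \max_(x <- S m) phi x) else [:: v0].
have le_mul n : n <= k.-1 * n by rewrite -{1}[n]mul1n leq_mul2r; lia.
have S_inv n : [/\ size (S n) = (k.-1 * n).+1, forall w, w \in S n -> V' w
    & pairwise ltn (map phi (S n))].
  elim: n => [|n [S_size S_V' S_sorted]]; first by split; rewrite ?muln0 // => w; rewrite inE => /eqP->.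
  have [|s_size s_V' s_sorted _] := gP (nth v0 (S n) n, \max_(x <- S n) phi x).
    by apply: S_V'; rewrite mem_nth // S_size ltnS.
  rewrite /= in s_V' *; split.
  - by rewrite size_cat S_size s_size mulnS; lia.
  - by move=> w; rewrite mem_cat => /orP[/S_V'|/s_V'[]].
  - rewrite map_cat pairwise_cat S_sorted -(sorted_pairwise ltn_trans) s_sorted !andbT.
    apply/allrelP => _ _ /mapP[x xS ->] /mapP[y /s_V'[_ lt_y] ->].
    by apply: leq_ltn_trans lt_y; apply: (leq_bigmax_seq x xS).
(* The lists extend one another and [S i] has more than [i] entries, so the diagonal reads off their
   common limit without using the default [v0]. *)
pose f i := nth v0 (S i) i.
have S_prefix m n i : m <= n -> i < size (S m) -> nth v0 (S n) i = nth v0 (S m) i.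
  move=> /subnK <- lt_i; elim: (n - m) => // d IH; rewrite addSn /= nth_cat.
  have [size_d _ _] := S_inv (d + m); have [size_m _ _] := S_inv m.
  rewrite (_ : i < size _) //; rewrite size_d; rewrite size_m in lt_i.
  by apply: leq_trans lt_i _; rewrite ltnS leq_mul2l leq_addl orbT.
have fE n i : i < size (S n) -> f i = nth v0 (S n) i.
  move=> lt_i; have [le_in|lt_ni] := leqP i n; last by rewrite /f (S_prefix n) // ltnW.
  by rewrite /f (S_prefix i n) //; have [-> _ _] := S_inv i; rewrite ltnS.
have phi_lt i j : i < j -> phi (f i) < phi (f j).
  move=> lt_ij; have [size_j _ pair_j] := S_inv j.
  have lt_j : j < size (S j) by rewrite size_j ltnS.
  rewrite (fE j i) ?(ltn_trans lt_ij) // (fE j j) //.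
  rewrite -!(nth_map _ 0 phi) ?(ltn_trans lt_ij) //.
  by apply: (pairwiseP 0 pair_j); rewrite // inE size_map ?(ltn_trans lt_ij).
apply: (@bfs_increasing_tree _ k f k_gt1 _ E) => //.
- by apply: (@increasing_inj _ phi) => i; apply: phi_lt.
- move=> n; have [size_n V'n _] := S_inv n.
  have [|s_size _ _] := gP (nth v0 (S n) n, \max_(x <- S n) phi x).
    by apply: V'n; rewrite mem_nth // size_n ltnS.
  set s := g _ in s_size *; rewrite (_ : [fset w in _]%fset = bfs_edge k f n) //.
  have f_s t : t < k.-1 -> f ((k.-1 * n).+1 + t) = nth v0 s t.
    move=> lt_t; have [size_n1 _ _] := S_inv n.+1.
    rewrite (fE n.+1); last by rewrite size_n1 mulnS; lia.
    by rewrite /= nth_cat size_n ltnNge leq_addr /= addKn.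
  apply/fsetP => w; rewrite !inE; apply/orP/imfsetP => /= [[/eqP->|ws]|[j]].
  + by exists n; rewrite ?in_cons ?eqxx.
  + have lt_w := ws; rewrite -index_mem s_size in lt_w.
    exists ((k.-1 * n).+1 + index w s); last by rewrite f_s // nth_index.
    by rewrite in_cons mem_iota; apply/orP; right; lia.
  + rewrite in_cons => /orP[/eqP-> ->|]; first by left.
    rewrite mem_iota => /andP[le_j lt_j] ->; right.
    by rewrite -(subnKC le_j) f_s ?mem_nth ?s_size //; lia.
- by move=> i; apply: phi_lt.
Qed.

Theorem theorem2p1 (k : nat) (V : countType) (E : set {fset V})
    (hk : 2 <= k)
    (hV : infinite_set [set: V]%classic)
    (hunif : uniform k E)
    (hsimple : simple E) :
  (property_C k E <->
     (forall phi : V -> nat, bijective phi -> increasing_tree k E phi)) /\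
  ((forall phi : V -> nat, bijective phi -> increasing_tree k E phi) <->
     (forall phi : V -> nat, bijective phi -> increasing_path k E phi)).
Proof.
have c_tree : property_C k E ->
    forall phi : V -> nat, bijective phi -> increasing_tree k E phi.
  by move=> C phi /bij_inj phi_inj; apply: property_C_increasing_tree.
have tree_path : (forall phi : V -> nat, bijective phi -> increasing_tree k E phi) ->
    forall phi : V -> nat, bijective phi -> increasing_path k E phi.
  by move=> trees phi phi_bij; apply: increasing_tree_path (trees phi phi_bij) => //; apply: bij_inj.
have path_c := @increasing_path_property_C V k E hk hV hunif.
by split; split=> // h; [apply/path_c/tree_path | apply/c_tree/path_c].
Qed.
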